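(* Let $\sigma\ge1$ be a real number and $D\ge1$ an integer. Let $f:[0,1]\to[0,1]$ be $f(x)=(2-x)^{-\sigma}$, and let $\alpha,\beta\in\mathbb{R}^D$ be defined by $\alpha_\ell=\ell/D$ and $\beta_p=p/D$. Then the $D\times D$ counting matrix $M$ with entries $M[\ell,p]=f(\alpha_\ell\beta_p)$ satisfies $$\tau(M)\le D\cdot2^\sigma\cdot(3e)^{2D}\cdot2^{D-1}\le2^\sigma(7e)^{2D},$$ where $\tau(M)=\max_{0\ne b\in\mathbb{R}^D}\|M^{-1}b\|_\infty/\|b\|_\infty$.
   Context: The counting matrix associated with $f,\alpha,\beta$ and a real number $c$ is $M[\ell,p]=f(c+\alpha_\ell\beta_p)$; here $c=0$. *)

(* Defs.v *)
From HB Require Import structures.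
From mathcomp Require Import all_boot all_order all_algebra.
From mathcomp Require Import all_classical all_reals all_analysis.
Set Implicit Arguments.
Unset Strict Implicit.
Unset Printing Implicit Defensive.
Import Order.TTheory GRing.Theory Num.Theory.
Import numFieldNormedType.Exports.
Local Open Scope classical_set_scope.
Local Open Scope ring_scope.

Definition counting_matrix (R : realType) (D : nat) (f : R -> R)
    (alpha beta : 'cV[R]_D) (c : R) : 'M[R]_D :=
  \matrix_(l, p) f (c + alpha l 0 * beta p 0).

(* The norm of a column vector is the library's matrix norm, which is the      *)
(* maximum of the absolute values of the entries. The supremum is a maximum    *)
(* when 0 < D, see tau_max. Since invmx M = M for singular M, tau M has its    *)
(* intended meaning only when M \in unitmx.                                    *)
Definition tau (R : realType) (D : nat) (M : 'M[R]_D) : R :=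
  sup [set `|invmx M *m b| / `|b| | b in [set b : 'cV[R]_D | b != 0]].

Definition inv_pow (R : realType) (sigma x : R) : R := (2 - x) `^ (- sigma).

(* Indices run over 1, ..., D, hence the shift by one from 'I_D. *)
Definition grid (R : realType) (D : nat) : 'cV[R]_D :=
  \col_(l < D) (l.+1%:R / D%:R).

Lemma inv_pow_itv (R : realType) (sigma x : R) :
  1 <= sigma -> 0 <= x <= 1 -> 0 <= inv_pow sigma x <= 1.
Proof.
move=> s1 /andP[x0 x1]; rewrite /inv_pow powR_ge0 /=.
have h : 1 <= 2 - x by rewrite lerBrDr -[2]/(1 + 1) lerD2l.
rewrite powRN invf_le1; last by rewrite powR_gt0 // (lt_le_trans ltr01).
by rewrite -[leLHS](powRr0 (2 - x)) ler_powR // (le_trans ler01).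
Qed.

Lemma grid_itv (R : realType) (D : nat) (l : 'I_D) :
  0 <= grid R D l 0 <= 1.
Proof.
have D0 : (0 < D)%N by apply: leq_ltn_trans (ltn_ord l).
rewrite mxE divr_ge0 ?ler0n //= ler_pdivrMr ?ltr0n // mul1r ler_nat.
exact: ltn_ord.
Qed.

Lemma tau_max (R : realType) (D : nat) (M : 'M[R]_D) : (0 < D)%N ->
  (exists2 b : 'cV[R]_D, b != 0 & `|invmx M *m b| / `|b| = tau M) /\
  (forall b : 'cV[R]_D, b != 0 -> `|invmx M *m b| / `|b| <= tau M).
Proof.
move=> D0; pose A := invmx M.
pose F (i : 'I_D) := \sum_j `|A i j|.
have F0 i : 0 <= F i by apply: sumr_ge0.
case: (@Order.TotalTheory.arg_maxP _ _ _ (Ordinal D0) xpredT F isT) => i0 _ Fmax.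
pose b0 : 'cV[R]_D := \col_j (if A i0 j < 0 then -1 else 1).
have coordle (v : 'cV[R]_D) i : `|v i 0| <= `|v|.
  rewrite [leRHS]/Num.norm /= mx_normrE; apply/bigmax_geP; right.
  by exists (i, 0).
have normle (v : 'cV[R]_D) (c : R) : 0 <= c ->
    (forall i, `|v i 0| <= c) -> `|v| <= c.
  move=> c0 h; rewrite [leLHS]/Num.norm /= mx_normrE; apply: bigmax_le => //.
  by move=> [i j] _ /=; rewrite (ord1 j).
have ub (b : 'cV[R]_D) : b != 0 -> `|A *m b| / `|b| <= F i0.
  move=> bn0; rewrite ler_pdivrMr ?normr_gt0 //; apply: normle.
    by rewrite mulr_ge0.
  move=> i; rewrite mxE (le_trans (ler_norm_sum _ _ _)) //.
  apply: (@le_trans _ _ (F i * `|b|)); last first.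
    by rewrite ler_wpM2r //; exact: Fmax.
  rewrite /F mulr_suml; apply: ler_sum => j _.
  by rewrite normrM ler_wpM2l.
have b0E j : `|b0 j 0| = 1 by rewrite mxE; case: ifP; rewrite ?normrN normr1.
have nb0 : `|b0| = 1.
  apply/eqP; rewrite eq_le -{2}(b0E (Ordinal D0)) coordle andbT.
  by apply: normle => // i; rewrite b0E.
have b0n0 : b0 != 0 by rewrite -normr_gt0 nb0.
have eqF : `|A *m b0| / `|b0| = F i0.
  apply/eqP; rewrite eq_le ub //= nb0 divr1 (le_trans _ (coordle _ i0)) //.
  rewrite mxE (le_trans _ (ler_norm _)) // /F; apply: ler_sum => j _.
  rewrite mxE; case: ltrP => h; first by rewrite ltr0_norm // mulrN1.
  by rewrite mulr1 ger0_norm.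
pose S := [set `|A *m b| / `|b| | b in [set b : 'cV[R]_D | b != 0]].
have tauE : tau M = F i0.
  apply/eqP; rewrite eq_le; apply/andP; split.
    by apply: ge_sup; [exists (F i0), b0 | move=> _ [b bn0 <-]; exact: ub].
  apply: (@ub_le_sup _ S); last by exists b0.
  by exists (F i0) => _ [b bn0 <-]; exact: ub.
by split; [exists b0; rewrite ?tauE | move=> b bn0; rewrite tauE; exact: ub].
Qed.

(* Main.v *)
Require Import Defs.
From HB Require Import structures.
From mathcomp Require Import all_boot all_order all_algebra.
From mathcomp Require Import all_classical all_reals all_analysis.
From mathcomp Require Import ring lra zify.
Import Order.TTheory GRing.Theory Num.Theory.
Import numFieldNormedType.Exports.
Local Open Scope ring_scope.

(* Write x_l = l/D and (2 - t)^(-sigma) = sum_k c_k t^k, where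
   c_k >= 2^(-sigma-k). Then M = sum_k c_k v_k v_k^T with v_k = (x_l^k)_l, so M is positive
   semidefinite and dropping the terms k >= D gives
     y^T M y >= 2^(-sigma-D+1) sum_(k < D) w_k^2,   w_k = sum_l x_l^k y_l.
   Lagrange interpolation recovers y_j = sum_k L_jk w_k, where L_jk are the
   coefficients of the j-th Lagrange polynomial, and sum_k |L_jk| is at most
     prod_(i != j) (1 + x_i) / |x_j - x_i|
       = binom(2D, D) binom(D, j) j / (D + j) <= 8^D <= (3e)^D.
   Since y^T M y <= D |y| |M y|, this gives
     |y|^2 <= 64^D 2^(sigma+D-1) D |y| |M y|. *)

(** * Partial sums of the negative binomial series *)

(** The rising factorial of [sigma] divided by k!, that is, the Taylor coefficient of (1 -
    u)^(-sigma). Substituting u = t/2 gives c_k = 2^(-sigma-k) [negbin_coef sigma k]. *)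
Definition negbin_coef {R : realType} (sigma : R) (k : nat) : R :=
  \prod_(i < k) ((sigma + i%:R) / i.+1%:R).

Definition negbin_sum {R : realType} (sigma : R) (n : nat) (u : R) : R :=
  \sum_(k < n) negbin_coef sigma k * u ^+ k.

Section NegativeBinomialSeries.
Variables (R : realType) (sigma : R).
Hypothesis sigma_ge1 : 1 <= sigma.
Local Notation a := (negbin_coef sigma).
Local Notation S := (negbin_sum sigma).

Lemma negbin_coefS n : n.+1%:R * a n.+1 = (sigma + n%:R) * a n.
Proof.
rewrite /negbin_coef big_ord_recr /=.
by rewrite mulrC -mulrA divfK ?pnatr_eq0 // mulrC.
Qed.

(** Each factor (sigma + i)/(i + 1) is at least 1 because sigma >= 1. This is the source of c_k >=
    2^(-sigma-k). *)
Lemma negbin_coef_ge1 n : 1 <= a n.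
Proof.
elim: n => [|n IH]; first by rewrite /negbin_coef big_ord0.
rewrite /negbin_coef big_ord_recr /= -[leLHS]mulr1 ler_pM //.
by rewrite ler_pdivlMr ?ltr0n // mul1r -addn1 natrD addrC lerD2r.
Qed.

Lemma negbin_coef_ge0 n : 0 <= a n.
Proof. exact: le_trans ler01 (negbin_coef_ge1 n). Qed.

Lemma is_derive_negbin_sum n (x : R) :
  is_derive x 1 (S n) (\sum_(k < n) a k * (k%:R * x ^+ k.-1)).
Proof.
have -> : S n = \sum_(k < n) (fun u : R => a k * u ^+ k).
  by apply/funext => u; rewrite /negbin_sum fct_sumE.
apply: is_derive_sum => k.
have -> : (fun u : R => a k * u ^+ k) = a k \*: ((@id R) ^+ k : R -> R).
  by apply/funext => u; rewrite /= exprfctE.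
apply: (is_derive_eq (is_deriveZ (a k) (is_deriveX k (is_derive_id x 1)))).
by rewrite /GRing.scale /= mulr1.
Qed.

(* [(1 - u)^(-sigma)] solves [(1 - u) y' = sigma y]; its partial sums solve it
   up to one monomial. *)
Lemma negbin_sum_ode n (x : R) :
  (1 - x) * (\sum_(k < n) a k * (k%:R * x ^+ k.-1)) =
  sigma * S n x - n%:R * a n * x ^+ n.-1.
Proof.
elim: n => [|n IH]; first by rewrite /negbin_sum !big_ord0; ring.
rewrite /negbin_sum !big_ord_recr /= mulrDr IH -/(S n x) negbin_coefS.
case: n {IH} => [|n] /=; first by rewrite expr0; ring.
by rewrite exprS; ring.
Qed.

(** By the approximate differential equation, F(x) = S(x) (1 - x)^sigma has derivative -(1 -
    x)^(sigma-1) times a single monomial. The mean value theorem on [0, u] with F(0) = 1 gives both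
    bounds, since (1 - x)^(sigma-1) <= 1 for sigma >= 1. *)
Lemma negbin_sum_remainder n (u : R) : 0 <= u < 1 ->
  0 <= 1 - S n.+1 u * (1 - u) `^ sigma <= n.+1%:R * a n.+1 * u ^+ n.+1.
Proof.
move=> /andP[u0 u1].
pose F (x : R) := S n.+1 x * (1 - x) `^ sigma.
pose dF (x : R) := - ((1 - x) `^ (sigma - 1) * (n.+1%:R * a n.+1 * x ^+ n)).
have dFE (x : R) : x < 1 -> is_derive x 1 F (dF x).
  move=> x1; have x1' : 0 < 1 - x by rewrite subr_gt0.
  have -> : F = S n.+1 * ((fun t => t `^ sigma) \o (cst 1 - id)).
    by apply/funext => t.
  have d1 := @is_derive_negbin_sum n.+1 x.
  have d2 : is_derive x 1 (cst 1 - id) (-1).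
    have := is_deriveB (is_derive_cst (1 : R) x 1) (is_derive_id x 1).
    by rewrite sub0r.
  have d3 :=
    @is_derive1_comp R _ (cst 1 - id) x _ _ (is_derive1_powR sigma x1') d2.
  apply: (is_derive_eq (is_deriveM d1 d3)).
  rewrite /GRing.scale /= -(@mulr_powRB1 _ (1 - x) sigma).
  - set d := \sum_(k < _) _; rewrite /dF.
    transitivity ((1 - x) `^ (sigma - 1) * ((1 - x) * d - sigma * S n.+1 x)).
      by ring.
    by rewrite negbin_sum_ode /=; ring.
  - exact: ltW.
  - exact: lt_le_trans sigma_ge1.
have [x xI] : exists2 x, x \in `[0, u] & F u - F 0 = dF x * (u - 0).
  apply: MVT_segment => //.
    by move=> x; rewrite in_itv /= => /andP[_ xu]; exact/dFE/(lt_trans xu).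
  apply: derivable_within_continuous => x; rewrite in_itv /= => /andP[_ xu].
  by have [] := dFE _ (le_lt_trans xu u1).
move: xI; rewrite in_itv /= => /andP[x0 xu].
have -> : F 0 = 1.
  rewrite /F /negbin_sum subr0 powR1 mulr1 big_ord_recl expr0 mulr1 /=.
  rewrite {1}/negbin_coef big_ord0 big1 ?addr0 // => i _.
  by rewrite exprS mul0r mulr0.
rewrite -/(F u) subr0 => FE; rewrite -(opprB (F u)) FE /dF mulNr opprK.
have c0 : 0 <= n.+1%:R * a n.+1 by rewrite mulr_ge0 // negbin_coef_ge0.
apply/andP; split.
  by rewrite !mulr_ge0 ?powR_ge0 ?exprn_ge0 ?negbin_coef_ge0.
rewrite exprSr [leRHS]mulrA ler_wpM2r // -[leRHS]mul1r ler_pM ?powR_ge0 //.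
- by rewrite mulr_ge0 ?exprn_ge0.
- have := @ge0_ler_powR R (sigma - 1) _ (1 - x) 1.
  by rewrite powR1; apply; rewrite ?nnegrE ?subr_ge0 //; lra.
- by rewrite ler_wpM2l // lerXn2r ?nnegrE.
Qed.

(** The partial sum at u = 3/4 is at most 4^sigma by the lower remainder bound, and its last term
    alone is a_n (3/4)^n. *)
Lemma negbin_coef_le n : a n <= 4 `^ sigma * (4 / 3) ^+ n.
Proof.
have u01 : 0 <= (3 / 4 : R) < 1 by lra.
have /andP[+ _] := negbin_sum_remainder n _ u01.
have -> : 1 - 3 / 4 = 4^-1 :> R by lra.
have p0 : 0 < (4 : R) `^ sigma by rewrite powR_gt0.
have -> : (4^-1 : R) `^ sigma = (4 `^ sigma)^-1.
  by rewrite -powR_inv1 // -powRrM mulN1r powRN.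
rewrite subr_ge0 ler_pdivrMr // mul1r => h.
rewrite -ler_pdivrMr ?exprn_gt0 ?divr_gt0 //.
rewrite -exprVn invf_div; apply: le_trans h.
rewrite /negbin_sum big_ord_recr /= lerDr sumr_ge0 // => i _.
by rewrite mulr_ge0 ?negbin_coef_ge0 // exprn_ge0 //; lra.
Qed.

(** Absorbs the linear factor of the remainder. The ratio 9/8 is small enough that 9/8 * 4/3 * 1/2 =
    3/4 < 1. *)
Lemma natr_le_geometric n : n%:R <= 8 * (9 / 8) ^+ n :> R.
Proof.
(* The summand 8 makes the induction close: 9/8 (n + 8) >= n + 1 + 8. *)
suff: n%:R + 8 <= 8 * (9 / 8) ^+ n :> R by lra.
elim: n => [|n IH]; first by rewrite expr0; lra.
have : 0 <= n%:R :> R by [].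
by rewrite exprS -natr1; lra.
Qed.

(** Since 2 - t = 2 (1 - t/2), the error is f(t) <= 1 times the relative remainder at u = t/2 <=
    1/2. The bound is uniform in t and geometric in n. *)
Lemma inv_pow_approx n (t : R) : 0 <= t <= 1 ->
  `|inv_pow sigma t - 2 `^ (- sigma) * S n.+1 (t / 2)|
    <= 8 * 4 `^ sigma * (3 / 4) ^+ n.+1.
Proof.
move=> /andP[t0 t1].
have u01 : 0 <= t / 2 < 1 by lra.
have /andP[r0 r1] := negbin_sum_remainder n _ u01.
have f01 : 0 <= inv_pow sigma t <= 1 by apply: inv_pow_itv => //; lra.
have v0 : 0 < 1 - t / 2 by lra.
have fE : inv_pow sigma t = 2 `^ (- sigma) / (1 - t / 2) `^ sigma.
  rewrite -powRN -powRM //; last exact: ltW.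
  by rewrite /inv_pow; congr (_ `^ _); field.
have -> : inv_pow sigma t - 2 `^ (- sigma) * S n.+1 (t / 2) =
    inv_pow sigma t * (1 - S n.+1 (t / 2) * (1 - t / 2) `^ sigma).
  rewrite fE; field; exact/lt0r_neq0/powR_gt0.
case/andP: f01 => f0 f1.
rewrite normrM !ger0_norm // (le_trans (ler_piMl r0 f1)) // (le_trans r1) //.
have -> : 8 * 4 `^ sigma * (3 / 4) ^+ n.+1 =
   8 * (9 / 8) ^+ n.+1 * (4 `^ sigma * (4 / 3) ^+ n.+1) * (1 / 2) ^+ n.+1 :> R.
  have -> : 3 / 4 = 9 / 8 * (4 / 3) * (1 / 2) :> R by lra.
  by rewrite !exprMn; ring.
have u0 : 0 <= t / 2 by lra.
apply: ler_pM; rewrite ?exprn_ge0 ?mulr_ge0 ?negbin_coef_ge0 //.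
  by apply: ler_pM; rewrite ?negbin_coef_ge0 ?natr_le_geometric ?negbin_coef_le.
by apply: lerXn2r; rewrite ?nnegrE //; lra.
Qed.

End NegativeBinomialSeries.

(** * Factorial estimates for the grid *)

Lemma bin_le_exp2 n k : ('C(n, k) <= 2 ^ n)%N.
Proof.
elim: n k => [|n IH] [|k] //; first by rewrite bin0 expn_gt0.
by rewrite binS expnS mul2n -addnn leq_add.
Qed.

Lemma fact_addn n m : ((n + m)`! = n`! * \prod_(i < m) (n + i).+1)%N.
Proof.
elim: m => [|m IH]; first by rewrite big_ord0 addn0 muln1.
by rewrite big_ord_recr /= addnS factS IH mulnC -mulnA.
Qed.

(* [(j - i) + (i - j)] is [|i - j|], the subtraction being truncated. *)
Lemma prod_dist_fact j m :
  (\prod_(i < j.+1 + m | i != j :> nat) ((j - i) + (i - j)) = j`! * m`!)%N.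
Proof.
elim: m => [|m IH];
  rewrite ?addn0 ?addnS big_mkcond big_ord_recr -big_mkcond /=.
  rewrite eqxx /= !muln1 -ffactnn ffact_prod.
  rewrite big_mkcond; apply: eq_bigr => i _; have := ltn_ord i.
  by case: eqP => /=; lia.
rewrite IH factS [RHS]mulnCA [RHS]mulnC; congr (_ * _)%N.
by case: eqP => /=; lia.
Qed.

(** Up to the common factor D^(D-1), this compares the products of 1 + x_i and |x_j - x_i|. With [j]
    counted from 0, their ratio is binom(2D, D) binom(D, j+1) (j+1)/(D+j+1) <= 4^D 2^D. *)
Lemma prod_grid_dist_bound D (j : 'I_D) :
  (\prod_(i < D | i != j) (D + i).+1 <=
   8 ^ D * \prod_(i < D | i != j) ((j - i) + (i - j)))%N.
Proof.
have jD := ltn_ord j; pose m := (D - j.+1)%N.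
have -> : (\prod_(i < D | i != j) ((j - i) + (i - j)) = j`! * m`!)%N.
  by have := prod_dist_fact j m; rewrite (_ : j.+1 + m = D)%N //; lia.
set P := (\prod_(i < D | _) _)%N.
have PE : (((D + j).+1 * P) = 'C(D + D, D) * D`!)%N.
  have := fact_addn D D; rewrite (bigD1 j) //= -/P.
  rewrite -(@bin_fact (D + D) D) ?leq_addr // addnK mulnA [RHS]mulnC => /eqP.
  by rewrite eqn_pmul2r ?fact_gt0 // => /eqP.
have DE : (D`! = 'C(D, j.+1) * (j.+1 * (j`! * m`!)))%N.
  by rewrite -(@bin_fact D j.+1) // factS /m; lia.
have hC : ('C(D + D, D) * 'C(D, j.+1) <= 8 ^ D)%N.
  rewrite -[8%N]/(2 ^ 3)%N -expnM (_ : 3 * D = (D + D) + D)%N; last by lia.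
  by rewrite expnD leq_mul // bin_le_exp2.
rewrite -(@leq_pmul2l (D + j).+1) // PE DE mulnA mulnA.
rewrite -[X in (_ <= X)%N]mulnCA -mulnA.
rewrite leq_mul // leq_mul //; lia.
Qed.

(** * Lagrange interpolation and moments *)

Section Lagrange.
Variables (R : realType) (D : nat) (x : 'I_D -> R).

Lemma size_prod_XsubC_neq (c : 'I_D -> R) (j : 'I_D) :
  size (\prod_(i < D | i != j) ('X - (c i)%:P)) = D.
Proof.
rewrite size_prod => [|i _]; last by rewrite polyXsubC_eq0.
under eq_bigr do rewrite size_XsubC.
rewrite sum_nat_const cardC1 card_ord; have := ltn_ord j; lia.
Qed.

(** Replacing the roots x_i by -x_i removes all signs from the coefficients; the induction is the
    triangle inequality for one more linear factor. *)
Lemma norm_coef_prod_XsubC (P : pred 'I_D) k : (forall i, 0 <= x i) ->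
  `|(\prod_(i < D | P i) ('X - (x i)%:P))`_k| <=
  (\prod_(i < D | P i) ('X - (- x i)%:P))`_k.
Proof.
move=> x0; elim/big_rec2: _ k => [k|i p q _ IH k].
  by rewrite coef1 normr_nat.
rewrite !mulrBl !coefB !coefXM !coefCM mulNr opprK.
rewrite (le_trans (ler_normB _ _)) // normrM (ger0_norm (x0 i)).
by rewrite lerD ?ler_wpM2l //; case: eqP; rewrite ?normr0.
Qed.

(** The sum of the coefficients of the sign-free product is its value at 1. *)
Lemma sum_norm_coef_prod_XsubC (j : 'I_D) : (forall i, 0 <= x i) ->
  \sum_(k < D) `|(\prod_(i < D | i != j) ('X - (x i)%:P))`_k| <=
  \prod_(i < D | i != j) (1 + x i).
Proof.
move=> x0; set Q := \prod_(i < D | i != j) ('X - (- x i)%:P).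
have -> : \prod_(i < D | i != j) (1 + x i) = Q.[1].
  by rewrite horner_prod; apply: eq_bigr => i _; rewrite hornerXsubC opprK.
rewrite (@horner_coef_wide _ D) ?size_prod_XsubC_neq //.
by apply: ler_sum => k _; rewrite expr1n mulr1 norm_coef_prod_XsubC.
Qed.

(** The product P vanishes at every node but x_j, so y_j P(x_j) is the sum of all y_l P(x_l), which
    is then expanded in monomials. Denominators stay cleared. *)
Lemma lagrange_moments (y : 'I_D -> R) (j : 'I_D) :
  y j * \prod_(i < D | i != j) (x j - x i) =
  \sum_(k < D) (\prod_(i < D | i != j) ('X - (x i)%:P))`_k *
    \sum_l x l ^+ k * y l.
Proof.
set P := \prod_(i < D | _) ('X - _).
have PE l : P.[x l] = \prod_(i < D | i != j) (x l - x i).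
  by rewrite horner_prod; apply: eq_bigr => i _; rewrite hornerXsubC.
transitivity (\sum_l y l * P.[x l]).
  rewrite [RHS](bigD1 j) //= [X in _ + X]big1 ?addr0 ?PE // => l lj.
  by rewrite PE (bigD1 l) //= subrr mul0r mulr0.
under eq_bigr do rewrite (@horner_coef_wide _ D) ?size_prod_XsubC_neq //
  big_distrr /=.
rewrite exchange_big; apply: eq_bigr => k _ /=; rewrite big_distrr /=.
by apply: eq_bigr => l _; ring.
Qed.

(** Every moment is at most the Euclidean norm of the moment vector, so only the sum of the absolute
    coefficients of P enters. *)
Lemma sqr_le_sum_sqr_moments (y : 'I_D -> R) (j : 'I_D) :
  (forall i, 0 <= x i) ->
  (y j * \prod_(i < D | i != j) (x j - x i)) ^+ 2 <=
  (\prod_(i < D | i != j) (1 + x i)) ^+ 2 *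
    \sum_(k < D) (\sum_l x l ^+ k * y l) ^+ 2.
Proof.
move=> x0; rewrite lagrange_moments.
pose w (k : nat) := \sum_l x l ^+ k * y l.
set W := \sum_(k < D) (\sum_l _) ^+ 2.
have W0 : 0 <= W by apply: sumr_ge0 => k _; rewrite sqr_ge0.
have wW (k : 'I_D) : `|w k| <= Num.sqrt W.
  rewrite -sqrtr_sqr ler_wsqrtr // /W (bigD1 k) //= lerDl.
  by apply: sumr_ge0 => i _; rewrite sqr_ge0.
have p0 : 0 <= \prod_(i < D | i != j) (1 + x i).
  by apply: prodr_ge0 => i _; rewrite addr_ge0.
rewrite -(sqr_sqrtr W0) -exprMn -real_normK ?num_real //.
apply: lerXn2r; rewrite ?nnegrE ?mulr_ge0 ?sqrtr_ge0 //.
apply: (le_trans (ler_norm_sum _ _ _)).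
apply: le_trans (ler_wpM2r (sqrtr_ge0 W) (sum_norm_coef_prod_XsubC j x0)).
rewrite mulr_suml; apply: ler_sum => k _.
by rewrite normrM ler_wpM2l ?wW.
Qed.

End Lagrange.

(** * Lower bound on the quadratic form and expansion by M *)

Section CountingMatrix.
Variables (R : realType) (sigma : R).
Hypothesis sigma_ge1 : 1 <= sigma.

(** The monomial (x_l x_p)^k factors over l and p, so each k contributes a square. *)
Lemma quadratic_form_negbin_sum (D : nat) (x y : 'I_D -> R) n :
  \sum_l \sum_p y l * y p *
    (2 `^ (- sigma) * negbin_sum sigma n (x l * x p / 2)) =
  \sum_(k < n) 2 `^ (- sigma) * negbin_coef sigma k / 2 ^+ k *
    (\sum_l x l ^+ k * y l) ^+ 2.
Proof.
transitivity (\sum_l \sum_p \sum_(k < n)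
   2 `^ (- sigma) * negbin_coef sigma k / 2 ^+ k *
     ((x l ^+ k * y l) * (x p ^+ k * y p))).
  apply: eq_bigr => l _; apply: eq_bigr => p _.
  rewrite /negbin_sum !big_distrr /=; apply: eq_bigr => k _.
  by rewrite !exprMn exprVn; ring.
under eq_bigr do rewrite exchange_big /=.
rewrite exchange_big; apply: eq_bigr => k _ /=.
rewrite expr2 big_distrlr /= big_distrr /=; apply: eq_bigr => l _.
by rewrite big_distrr.
Qed.

(** The infinite series is avoided: the bound is proved for truncations of f with an error tending
    to 0, and then the limit is taken. *)
Lemma sum_sqr_moments_le (D : nat) (x y : 'I_D -> R) :
  (forall i, 0 <= x i <= 1) ->
  \sum_(k < D) (\sum_l x l ^+ k * y l) ^+ 2 <=
  2 `^ sigma * 2 ^+ (D - 1) *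
    \sum_l \sum_p y l * y p * inv_pow sigma (x l * x p).
Proof.
move=> x01; set W := \sum_(k < D) _; set Q := \sum_l _.
pose w (k : nat) := \sum_l x l ^+ k * y l.
pose c : R := 2 `^ sigma * 2 ^+ (D - 1).
have c0 : 0 < c by rewrite mulr_gt0 ?powR_gt0 ?exprn_gt0.
suff : W / c <= Q by rewrite ler_pdivrMr // mulrC.
(* Bounds the effect on the quadratic form of the uniform error of [inv_pow_approx], without its
   geometric factor. *)
pose E : R := (\sum_l \sum_p `|y l * y p|) * (8 * 4 `^ sigma).
have WQ n : (D <= n)%N -> W / c <= Q + E * (3 / 4) ^+ n.+1.
  move=> Dn.
  pose P := \sum_l \sum_p y l * y p *
    (2 `^ (- sigma) * negbin_sum sigma n.+1 (x l * x p / 2)).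
  have PW : W / c <= P.
    rewrite /P quadratic_form_negbin_sum.
    pose G k := 2 `^ (- sigma) * negbin_coef sigma k / 2 ^+ k * w k ^+ 2.
    have G0 k : 0 <= G k.
      rewrite /G mulr_ge0 ?sqr_ge0 //.
      by rewrite !mulr_ge0 ?invr_ge0 ?exprn_ge0 ?powR_ge0 ?negbin_coef_ge0.
    suff : W / c <= \sum_(0 <= k < n.+1) G k by rewrite big_mkord.
    (* The terms k >= D are nonnegative and dropped; for k < D the weight is at least 2^(-sigma) /
       2^(D-1). *)
    rewrite (@big_cat_nat _ _ _ D) //=; last first.
      exact: ltnW.
    apply: ler_wpDr; first by rewrite sumr_ge0.
    rewrite big_mkord /W mulr_suml; apply: ler_sum => k _.
    rewrite /G -/(w k) mulrC ler_wpM2r ?sqr_ge0 // /c invfM powRN -mulrA.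
    rewrite ler_wpM2l ?invr_ge0 ?powR_ge0 //.
    rewrite -[leLHS]mul1r ler_pM ?invr_ge0 ?exprn_ge0 ?negbin_coef_ge1 //.
    rewrite lef_pV2 ?posrE ?exprn_gt0 // ler_weXn2l ?ler1n //.
    by have := ltn_ord k; lia.
  apply: (le_trans PW); rewrite -lerBlDl /P /Q -sumrB.
  apply: (le_trans (ler_norm _)); apply: (le_trans (ler_norm_sum _ _ _)).
  rewrite /E -mulrA mulr_suml; apply: ler_sum => l _.
  rewrite -sumrB mulr_suml; apply: (le_trans (ler_norm_sum _ _ _)).
  apply: ler_sum => p _; rewrite -mulrBr normrM ler_wpM2l // distrC.
  apply: inv_pow_approx => //.
  case/andP: (x01 l) => l0 l1; case/andP: (x01 p) => p0 p1.
  by rewrite mulr_ge0 // mulr_ile1.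
have cv : (Q + geometric E (3 / 4) n @[n --> \oo] --> Q + 0)%classic.
  apply: cvgD; first exact: cvg_cst.
  by apply: cvg_geometric; rewrite ger0_norm; lra.
rewrite -[Q]addr0 -(cvg_lim _ cv) //; apply: limr_ge.
  by apply/cvg_ex; exists (Q + 0).
(* The error of [WQ n] carries exponent n + 1, hence the threshold shifted by one. *)
exists D.+1 => // -[|n] //= Dn.
exact: WQ.
Qed.

Lemma mx_norm_coord_le (D : nat) (v : 'cV[R]_D) i : `|v i 0| <= `|v|.
Proof.
rewrite [leRHS]/Num.norm /= mx_normrE; apply/bigmax_geP; right.
by exists (i, 0).
Qed.

Lemma mx_norm_le (D : nat) (v : 'cV[R]_D) (c : R) : 0 <= c ->
  (forall i, `|v i 0| <= c) -> `|v| <= c.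
Proof.
move=> c0 h; rewrite [leLHS]/Num.norm /= mx_normrE; apply: bigmax_le => //.
by move=> [i j] _ /=; rewrite (ord1 j).
Qed.

(** Divides the cleared interpolation bound by A^2, which is nonzero because the grid points are
    distinct; [B <= 8 ^+ D * |A|] gives the constant after squaring. *)
Lemma grid_sqr_le (D : nat) (y : 'I_D -> R) (j : 'I_D) :
  y j ^+ 2 <= 8 ^+ (2 * D) *
    \sum_(k < D) (\sum_l grid R D l 0 ^+ k * y l) ^+ 2.
Proof.
have D0 : (0 < D)%N by apply: leq_ltn_trans (ltn_ord j).
have D0R : (D%:R : R) != 0 by rewrite pnatr_eq0 -lt0n.
pose x (i : 'I_D) : R := grid R D i 0.
have x0 i : 0 <= x i by have /andP[] := grid_itv R i.
have := sqr_le_sum_sqr_moments _ _ x y j x0; rewrite -/(x _).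
set W := \sum_(k < D) _; set A := \prod_(i < D | _) _.
set B := \prod_(i < D | _) _ => AB.
have W0 : 0 <= W by apply: sumr_ge0 => k _; rewrite sqr_ge0.
have A0 : A != 0.
  apply/prodf_neq0 => i ij; rewrite /x !mxE -mulrBl mulf_neq0 ?invr_eq0 //.
  by rewrite subr_eq0 eqr_nat eqSS eq_sym.
have B0 : 0 <= B by apply: prodr_ge0 => i _; rewrite addr_ge0.
have BA : B <= 8 ^+ D * `|A|.
  (* Numerator and denominator both have D - 1 factors, so the same power of 1/D is pulled out of
     each. *)
  have -> : B = (\prod_(i < D | i != j) (D + i).+1)%:R *
      \prod_(i < D | i != j) D%:R^-1.
    rewrite natr_prod -big_split; apply: eq_bigr => i _ /=.
    by rewrite /x mxE -addnS natrD; field.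
  have -> : `|A| = (\prod_(i < D | i != j) ((j - i) + (i - j)))%N%:R *
      \prod_(i < D | i != j) D%:R^-1.
    rewrite normr_prod natr_prod -big_split; apply: eq_bigr => i _ /=.
    rewrite /x !mxE -mulrBl normrM normfV normr_nat; congr (_ / _).
    case: (leqP i j) => ij.
      rewrite (eqP (_ : i - j == 0)%N) ?subn_eq0 // addn0 ger0_norm.
        by rewrite -natrB // subSS.
      by rewrite subr_ge0 ler_nat.
    rewrite distrC (eqP (_ : j - i == 0)%N) ?subn_eq0 1?ltnW // add0n ger0_norm.
      by rewrite -natrB 1?ltnW // subSS.
    by rewrite subr_ge0 ler_nat ltnW.
  rewrite mulrA ler_wpM2r //.
    by apply: prodr_ge0 => i _; rewrite invr_ge0.
  by rewrite -natrX -natrM ler_nat prod_grid_dist_bound.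
have A20 : 0 < A ^+ 2 by rewrite exprn_even_gt0.
rewrite -(ler_pM2r A20) -exprMn (le_trans AB) // [leRHS]mulrAC ler_wpM2r //.
rewrite mulnC exprM -exprMn -(real_normK (num_real (_ * A))).
rewrite normrM normrX normr_nat.
by apply: lerXn2r; rewrite ?nnegrE ?mulr_ge0 ?exprn_ge0.
Qed.

(** Phrased without [invmx], so that it yields both the invertibility of M and the bound on its
    inverse. *)
Lemma counting_matrix_expansive (D : nat) (y : 'cV[R]_D) :
  `|y| <= D%:R * 2 `^ sigma * 8 ^+ (2 * D) * 2 ^+ (D - 1) *
    `|counting_matrix (inv_pow sigma) (grid R D) (grid R D) 0 *m y|.
Proof.
set M := counting_matrix _ _ _ _; set T : R := D%:R * _ * _ * _.
have T0 : 0 <= T by rewrite /T !mulr_ge0 ?powR_ge0 ?exprn_ge0.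
have [->|y0] := eqVneq y 0; first by rewrite normr0 mulr_ge0.
(* Multiplying by [|y|] reduces the claim to a bound on its square by the quadratic form. *)
rewrite -(ler_pM2l (_ : 0 < `|y|)) ?normr_gt0 // -expr2.
set W := \sum_(k < D) (\sum_l grid R D l 0 ^+ k * y l 0) ^+ 2.
have W0 : 0 <= W by apply: sumr_ge0 => k _; rewrite sqr_ge0.
have yW : `|y| ^+ 2 <= 8 ^+ (2 * D) * W.
  have h0 : 0 <= 8 ^+ (2 * D) * W by rewrite mulr_ge0 ?exprn_ge0.
  rewrite -(sqr_sqrtr h0) lerXn2r ?nnegrE ?sqrtr_ge0 //.
  apply: mx_norm_le; rewrite ?sqrtr_ge0 // => i.
  by rewrite -sqrtr_sqr ler_wsqrtr // (grid_sqr_le _ (fun l => y l 0)).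
have Wq := sum_sqr_moments_le D (fun i => grid R D i 0) (fun l => y l 0)
  (@grid_itv R D).
have qM : \sum_l \sum_p y l 0 * y p 0 *
    inv_pow sigma (grid R D l 0 * grid R D p 0) <= D%:R * (`|y| * `|M *m y|).
  have -> : D%:R * (`|y| * `|M *m y|) = \sum_(l < D) `|y| * `|M *m y|.
    by rewrite sumr_const card_ord mulr_natl.
  apply: ler_sum => l _; rewrite (_ : \sum_p _ = y l 0 * (M *m y) l 0).
    rewrite (le_trans (ler_norm _)) // normrM.
    by rewrite ler_pM ?mx_norm_coord_le.
  rewrite [(M *m y) l 0]mxE big_distrr; apply: eq_bigr => p _ /=.
  by rewrite [M l p]mxE add0r; ring.
have c0 : 0 <= 2 `^ sigma * 2 ^+ (D - 1) :> R.
  by rewrite mulr_ge0 ?powR_ge0 ?exprn_ge0.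
apply: (le_trans yW).
have e0 : 0 <= 8 ^+ (2 * D) :> R by rewrite exprn_ge0.
apply: (le_trans (ler_wpM2l e0 Wq)).
apply: (le_trans (ler_wpM2l e0 (ler_wpM2l c0 qM))).
by rewrite /T le_eqVlt; apply/orP; left; apply/eqP; ring.
Qed.

End CountingMatrix.

(** * Invertibility, the bound on [tau], and numerical constants *)

(** Expansion forces a trivial kernel. As [kermx] is a left kernel, it is taken for the transpose
    and its columns are tested. *)
Lemma expansive_unitmx (R : realType) (D : nat) (M : 'M[R]_D) (T : R) :
  (forall y : 'cV[R]_D, `|y| <= T * `|M *m y|) -> M \in unitmx.
Proof.
move=> MT; rewrite -unitmx_tr -row_free_unit -kermx_eq0 -trmx_eq0.
set K := (kermx _)^T.
have MK : M *m K = 0 by rewrite -[M]trmxK -trmx_mul mulmx_ker trmx0.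
apply/eqP/matrixP => i j; have := MT (col j K).
rewrite colE mulmxA MK mul0mx normr0 mulr0 normr_le0 -colE => /eqP/matrixP.
by move=> /(_ i 0); rewrite !mxE.
Qed.

(** At a maximizer b, the hypothesis is applied to y = M^(-1) b. *)
Lemma expansive_tau_le (R : realType) (D : nat) (M : 'M[R]_D) (T : R) :
  (0 < D)%N -> (forall y : 'cV[R]_D, `|y| <= T * `|M *m y|) -> tau M <= T.
Proof.
move=> D0 MT; have Mu := expansive_unitmx _ _ _ _ MT.
have [[b b0 <-] _] := tau_max M D0.
by rewrite ler_pdivrMr ?normr_gt0 // (le_trans (MT _)) // mulKVmx.
Qed.

(** Exactly what is needed for 8 <= 3e, which turns 8^(2D) into (3e)^(2D). *)
Lemma expR1_ge (R : realType) : 8 / 3 <= expR 1 :> R.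
Proof.
have h : (33 / 32) ^+ 32 <= expR 1 :> R.
  have -> : expR 1 = expR (32^-1) ^+ 32 :> R.
    by rewrite -expRM_natl mulfV // pnatr_eq0.
  apply: lerXn2r; rewrite ?nnegrE ?expR_ge0 ?divr_ge0 //.
  by apply: le_trans (expR_ge1Dx _); lra.
(* The 32nd power is five squarings; the decimals below are the successive powers of 33/32 rounded
   down, outermost first. *)
apply: le_trans h; rewrite -[32%N]/(2 * 2 * 2 * 2 * 2)%N !exprM.
have sq (u v t : R) : 0 <= u -> v <= u * u -> u <= t -> v <= t ^+ 2.
  by move=> u0 vu ut; rewrite (le_trans vu) // expr2 ler_pM.
apply: (sq (1635 / 1000)); [lra | lra |].
apply: (sq (12787 / 10000)); [lra | lra |].
apply: (sq (11308 / 10000)); [lra | lra |].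
apply: (sq (10634 / 10000)); [lra | lra |].
apply: (sq (33 / 32)); lra.
Qed.

Theorem theorem18 (R : realType) (sigma : R) (D : nat)
    (hsigma : 1 <= sigma) (hD : (1 <= D)%N) :
  let e : R := expR 1 in
  let M : 'M[R]_D := counting_matrix (inv_pow sigma) (grid R D) (grid R D) 0 in
  [/\ M \in unitmx,
      tau M <= D%:R * 2 `^ sigma * (3 * e) ^+ (2 * D) * 2 ^+ (D - 1) &
      D%:R * 2 `^ sigma * (3 * e) ^+ (2 * D) * 2 ^+ (D - 1)
        <= 2 `^ sigma * (7 * e) ^+ (2 * D)].
Proof.
move=> e M.
have MT := counting_matrix_expansive R sigma hsigma D.
have e83 : 8 / 3 <= e := expR1_ge R.
have s0 : 0 <= 2 `^ sigma :> R := powR_ge0 _ _.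
split; first exact: expansive_unitmx MT.
  apply: (le_trans (expansive_tau_le _ _ _ _ hD MT)).
  rewrite ler_wpM2r ?exprn_ge0 // ler_wpM2l ?mulr_ge0 //.
  by apply: lerXn2r; rewrite ?nnegrE //; lra.
have e0 : 0 <= e ^+ (2 * D) by rewrite exprn_ge0 // expR_ge0.
(* From D <= 2^D and 2^(D-1) <= 2^D, the left side is at most 36^D <= 49^D. *)
have nD : (D * 3 ^ (2 * D) * 2 ^ (D - 1) <= 7 ^ (2 * D))%N.
  apply: (@leq_trans ((2 ^ D * 9 ^ D) * 2 ^ D)).
    rewrite [(3 ^ _)%N]expnM leq_mul ?leq_exp2l ?leq_subr //.
    by rewrite leq_mul // ltnW // ltn_expl.
  by rewrite -!expnMn [leqRHS]expnM leq_exp2r.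
rewrite -(ler_nat R) !natrM !natrX in nD.
rewrite !exprMn; set X := e ^+ _.
have -> : D%:R * 2 `^ sigma * (3 ^+ (2 * D) * X) * 2 ^+ (D - 1) =
    2 `^ sigma * (D%:R * 3 ^+ (2 * D) * 2 ^+ (D - 1) * X) by ring.
by rewrite ler_wpM2l // ler_wpM2r.
Qed.
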